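(* Let $G$ be a simple graph of order $n$ with average degree $d$ and minimum degree $\delta$, and let $0=\sigma_0\le\sigma_1\le\cdots\le\sigma_{n-1}$ be its Laplacian eigenvalues. If $2\le\sigma_1\le\sigma_{n-1}\le 2d-2$, then $\kappa'(G)=\delta$.
   Context: The Laplacian matrix of $G$ is $L(G)=D(G)-A(G)$, where $D(G)$ is the diagonal matrix of vertex degrees and $A(G)$ the adjacency matrix; its eigenvalues are the Laplacian eigenvalues, ordered increasingly. The average degree is $d=\frac{1}{n}\sum_v d_v$. $\kappa'(G)$ denotes the edge connectivity of $G$: the minimum number of edges whose deletion makes $G$ disconnected. *)

(* Defs.v *)
From mathcomp Require Import all_boot all_order all_algebra.

Set Implicit Arguments.
Unset Strict Implicit.
Unset Printing Implicit Defensive.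

Import Order.TTheory GRing.Theory Num.Theory.

(* A graph of order n is given by its adjacency relation e on 'I_n; simplicity
   (symmetric e, irreflexive e) is a separate hypothesis. *)

Definition degree (n : nat) (e : rel 'I_n) (v : 'I_n) : nat := #|[set w | e v w]|.

(* Degrees are at most n, so the neutral element n does not affect the minimum
   when n > 0. *)
Definition min_degree (n : nat) (e : rel 'I_n) : nat :=
  \big[minn/n]_(v < n) degree e v.

Definition edges (n : nat) (e : rel 'I_n) : {set {set 'I_n}} :=
  [set [set p.1; p.2] | p in [pred p : 'I_n * 'I_n | e p.1 p.2]].

Definition delete_edges (n : nat) (e : rel 'I_n) (F : {set {set 'I_n}}) : rel 'I_n :=
  [rel x y | e x y && ([set x; y] \notin F)].

Definition connected (n : nat) (e : rel 'I_n) : bool :=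
  [forall x, forall y, connect e x y].

Definition disconnecting (n : nat) (e : rel 'I_n) (F : {set {set 'I_n}}) :
    bool :=
  (F \subset edges e) && ~~ connected (delete_edges e F).

(* If n > 1 then edges e is disconnecting, so this is a genuine minimum;
   if n <= 1 there is no disconnecting set and the value is #|edges e| = 0. *)
Definition edge_connectivity (n : nat) (e : rel 'I_n) : nat :=
  #|[arg min_(F < edges e | disconnecting e F) #|F|]|.

Local Open Scope ring_scope.

Definition average_degree (R : fieldType) (n : nat) (e : rel 'I_n) : R :=
  n%:R^-1 * \sum_(v < n) (degree e v)%:R.

Definition degree_mx (R : pzRingType) (n : nat) (e : rel 'I_n) : 'M[R]_n :=
  diag_mx (\row_v (degree e v)%:R).

Definition adjacency_mx (R : pzRingType) (n : nat) (e : rel 'I_n) : 'M[R]_n :=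
  \matrix_(u, v) (e u v)%:R.

Definition laplacian_mx (R : pzRingType) (n : nat) (e : rel 'I_n) : 'M[R]_n :=
  degree_mx R e - adjacency_mx R e.

(* s lists the eigenvalues of A with multiplicity, in increasing order; the
   second condition forces size s = n. *)
Definition ordered_eigenvalues (R : rcfType) (n : nat) (A : 'M[R]_n)
    (s : seq R) : Prop :=
  sorted <=%R s /\ char_poly A = \prod_(x <- s) ('X - x%:P).

(* Main.v *)
(* For an edge cut (S, ~: S) the vector n 1_S - |S| 1 is orthogonal to the kernel vector 1 of
   the Laplacian, so the variational bound for sigma_1 gives
   n |cut S| >= sigma_1 |S| |~: S| >= 2 |S| |~: S|.  Taking |S| <= |~: S|, hence
   |~: S| >= n / 2, this yields |cut S| >= |S|, which settles |S| >= delta.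
   If |S| <= delta, each vertex of S sends at least delta - (|S| - 1) edges out
   of S, and |S| (delta - |S| + 1) >= delta. *)
Require Import Defs.
From mathcomp Require Import all_boot all_order all_algebra.
From mathcomp Require Import complex.
From mathcomp Require Import ring lra zify.

Set Implicit Arguments.
Unset Strict Implicit.
Unset Printing Implicit Defensive.

Import Order.TTheory GRing.Theory Num.Theory.
Local Open Scope ring_scope.

Lemma char_poly_similar (F : fieldType) (n : nat) (P M : 'M[F]_n) :
  P \in unitmx -> char_poly (invmx P *m M *m P) = char_poly M.
Proof.
move=> Pu; rewrite /char_poly.
have -> : char_poly_mx (invmx P *m M *m P) =
    map_mx polyC (invmx P) *m char_poly_mx M *m map_mx polyC P.
  rewrite /char_poly_mx !map_mxM mulmxBr mulmxBl mul_mx_scalar -scalemxAl.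
  by rewrite -(map_mxM _ (invmx P) P) mulVmx // map_mx1 scalemx1.
rewrite !det_mulmx mulrAC -det_mulmx -map_mxM mulVmx // map_mx1 det1.
by rewrite mul1r.
Qed.

(** Only the head of a sorted list can lie strictly below the entry at index 1; with fewer than two
    entries the bound holds whatever the default value is. *)
Lemma count_lt_nth1 (R : realDomainType) (s : seq R) :
  sorted <=%R s -> (count (fun y => y < s`_1)%R s <= 1)%N.
Proof.
case: s => [//|a [|b s]] //=; first by rewrite addn0 leq_b1.
case/andP=> _; rewrite (path_sortedE le_trans) => /andP[/allP sb _].
rewrite ltxx add0n; have -> : count (fun y => y < b) s = 0%N.
  apply/eqP; rewrite -leqn0 leqNgt -has_count; apply/hasPn => y ys.
  by rewrite -leNgt sb.
by rewrite addn0 leq_b1.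
Qed.

Section Spectral.
Local Open Scope sesquilinear_scope.
Local Open Scope complex_scope.

Lemma trmxC_real (R : rcfType) (m n : nat) (M : 'M[R]_(m, n)) :
  (map_mx (real_complex R) M)^t* = map_mx (real_complex R) M^T.
Proof.
apply/matrixP => i j; rewrite !mxE conj_Creal //.
by apply/complex_realP; exists (M j i).
Qed.

(* The spectral theorem of the library is over numClosedFieldType, hence the
   passage to R[i].  Only one diagonal entry can be below s`_1; the coordinates
   of u pick it out, so x has no component along it. *)
Lemma rayleigh_second_eigenvalue (R : rcfType) (n : nat) (A : 'M[R]_n)
    (s : seq R) (mu : R) (u x : 'rV[R]_n) :
  A^T = A -> ordered_eigenvalues A s ->
  u != 0 -> u *m A = mu *: u -> mu < s`_1 -> x *m u^T = 0 ->
  s`_1 * (x *m x^T) 0 0 <= (x *m A *m x^T) 0 0.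
Proof.
move=> Asym [s_sorted charA] u_neq0 uA mu_lt xu0.
pose toC := real_complex R; pose B := map_mx toC A.
have Bnormal : B \is normalmx by apply/normalmxP; rewrite trmxC_real Asym.
have /orthomx_spectralP := Bnormal.
set P := spectralmx B; set d := spectral_diag B => B_eq.
have P_unitary : P \is unitarymx := spectral_unitarymx B.
have P_unit : P \in unitmx := unitarymx_unit P_unitary.
(* Both lists are the roots of one characteristic polynomial, so they agree with multiplicities. *)
have perm_d : perm_eq (map toC s) [seq d 0 i | i : 'I_n].
  apply: prod_XsubC_eq; rewrite big_map big_image /=.
  have -> : \prod_(i < n) ('X - (d 0 i)%:P) = char_poly (diag_mx d).
    rewrite char_poly_trig; last by apply: diag_mx_is_trig.
    by apply: eq_bigr => i _; rewrite mxE eqxx.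
  rewrite -(@char_poly_similar _ _ P) // -B_eq -map_char_poly charA.
  by rewrite rmorph_prod; apply: eq_bigr => a _; rewrite /= map_polyXsubC.
have small_uniq (i j : 'I_n) :
    d 0 i < toC s`_1 -> d 0 j < toC s`_1 -> i = j.
  move=> di dj; apply: (@card_le1_eqP _ [pred k | d 0 k < toC s`_1]) => //.
  have := count_lt_nth1 s_sorted.
  rewrite -(eq_count (a1 := preim toC (fun y => y < toC s`_1))); last first.
    by move=> y /=; rewrite ltcR.
  by rewrite -count_map (permP perm_d) count_map -sum1_count big_enum_cond sum1_card.
(* The order on [R[i]] is partial; the negation of [<] can be turned around because each [d 0 i] is
   the image of an entry of [s]. *)
have d_large i : ~~ (d 0 i < toC s`_1) -> toC s`_1 <= d 0 i.
  have : d 0 i \in map toC s by rewrite (perm_mem perm_d); apply: image_f.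
  by case/mapP => b _ ->; rewrite ltcR lecR -leNgt.
(* Coordinates of [x] and [u] in the eigenbasis, kept opaque by the existentials. *)
have [y yE] : exists y, y = map_mx toC x *m invmx P by eexists.
have [w wE] : exists w, w = map_mx toC u *m invmx P by eexists.
have yt : y^t* = P *m map_mx toC x^T.
  rewrite yE invmx_unitary // trmx_mul map_mxM trmxC_real.
  by rewrite map_trmx trmxK -map_mx_comp map_mx_id // => z; rewrite /= conjCK.
have wt : w^t* = P *m map_mx toC u^T.
  rewrite wE invmx_unitary // trmx_mul map_mxM trmxC_real.
  by rewrite map_trmx trmxK -map_mx_comp map_mx_id // => z; rewrite /= conjCK.
have wD i : w 0 i * d 0 i = toC mu * w 0 i.
  have : w *m diag_mx d = toC mu *: w.
    apply: (can_inj (mulmxK P_unit)).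
    rewrite -scalemxAl wE mulmxKV // -!mulmxA (mulmxA (invmx P)) -B_eq.
    by rewrite -map_mxM uA map_mxZ.
  by move/rowP/(_ i); rewrite mul_mx_diag !mxE.
have [i0 wi0] : exists i, w 0 i != 0.
  apply/rV0Pn; apply: contraNneq u_neq0 => w0.
  have : map_mx toC u = 0.
    by rewrite -(mulmxKV P_unit (map_mx toC u)) -wE w0 mul0mx.
  by move/eqP; rewrite map_mx_eq0.
have d_i0 : d 0 i0 = toC mu by apply: (mulfI wi0); rewrite wD mulrC.
have di0_small : d 0 i0 < toC s`_1 by rewrite d_i0 ltcR.
have d_ge i : i != i0 -> toC s`_1 <= d 0 i.
  move=> i_neq; apply: d_large; apply: contra i_neq => di.
  by rewrite (small_uniq _ _ di di0_small).
have w_eq0 i : i != i0 -> w 0 i = 0.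
  move=> i_neq; apply: contraTeq (d_ge i i_neq) => wi.
  have -> : d 0 i = toC mu by apply: (mulfI wi); rewrite wD mulrC.
  by rewrite lecR -ltNge.
have yw : y *m w^t* = 0.
  by rewrite wt yE mulmxA mulmxKV // -map_mxM xu0 map_mx0.
have yi0 : y 0 i0 = 0.
  move/matrixP/(_ 0 0): yw; rewrite !mxE (bigD1 i0) //= big1 => [|i /w_eq0 wi].
    rewrite !mxE addr0 => /eqP.
    by rewrite mulf_eq0 conjC_eq0 (negPf wi0) orbF => /eqP.
  by rewrite !mxE wi conjC0 mulr0.
rewrite -lecR rmorphM /=.
have -> : ((x *m x^T) 0 0)%:C = (y *m y^t*) 0 0.
  by rewrite yt yE mulmxA mulmxKV // -map_mxM [RHS]mxE.
have -> : ((x *m A *m x^T) 0 0)%:C = (y *m diag_mx d *m y^t*) 0 0.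
  rewrite yt yE mulmxA -!(mulmxA (map_mx toC x)) -B_eq.
  by rewrite mulmxA -!map_mxM [RHS]mxE.
(* Termwise comparison: both terms vanish at [i0], and [d_ge] handles all other indices. *)
rewrite mul_mx_diag !mxE mulr_sumr; apply: ler_sum => i _; rewrite !mxE.
have [->|/d_ge di] := eqVneq i i0; first by rewrite yi0 !(mul0r, mulr0).
by rewrite [y 0 i * d 0 i]mulrC -mulrA ler_wpM2r // mul_conjC_ge0.
Qed.

End Spectral.

(** * Cuts and the quadratic form of the Laplacian *)

(** For symmetric [e] each crossing edge counts once, oriented out of [S]. *)
Definition cut_size (n : nat) (e : rel 'I_n) (S : {set 'I_n}) : nat :=
  (\sum_(u in S) \sum_(v in ~: S) e u v)%N.

Lemma degreeE (n : nat) (e : rel 'I_n) v : degree e v = (\sum_(w < n) e v w)%N.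
Proof.
rewrite /degree -sum1_card big_mkcond /=; apply: eq_bigr => w _.
by rewrite inE; case: (e v w).
Qed.

Lemma cut_sizeC (n : nat) (e : rel 'I_n) S :
  symmetric e -> cut_size e (~: S) = cut_size e S.
Proof.
move=> e_sym; rewrite /cut_size setCK exchange_big /=.
by apply: eq_bigr => u _; apply: eq_bigr => v _; rewrite e_sym.
Qed.

Section Laplacian.
Variables (R : rcfType) (n : nat) (e : rel 'I_n).
Hypothesis e_sym : symmetric e.
Let L := laplacian_mx R e.

Lemma laplacian_mx_sym : L^T = L.
Proof.
apply/matrixP => i j; rewrite !mxE e_sym eq_sym.
by case: eqVneq => [->|].
Qed.

(** Differences of coordinates make it visible that constants are in the kernel and that only
    crossing edges contribute for an indicator vector. *)
Lemma mul_row_laplacian (x : 'rV[R]_n) j :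
  (x *m L) 0 j = \sum_i (x 0 j - x 0 i) * (e i j)%:R.
Proof.
rewrite /L /laplacian_mx mulmxBr mul_mx_diag !mxE degreeE natr_sum mulr_sumr.
by rewrite -sumrB; apply: eq_bigr => i _; rewrite !mxE mulrBl e_sym.
Qed.

Lemma mul_const_laplacian (a : R) : (const_mx a : 'rV_n) *m L = 0.
Proof.
apply/rowP => j; rewrite mul_row_laplacian big1 ?mxE // => i _.
by rewrite !mxE subrr mul0r.
Qed.

Lemma laplacian_form_cut (S : {set 'I_n}) (x := \row_v (v \in S)%:R : 'rV[R]_n) :
  (x *m L *m x^T) 0 0 = (cut_size e S)%:R.
Proof.
rewrite mxE /cut_size natr_sum [RHS]big_mkcond /=; apply: eq_bigr => j _.
rewrite mul_row_laplacian !mxE; case: ifP => jS; last by rewrite mulr0.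
rewrite mulr1 natr_sum [RHS]big_mkcond /=; apply: eq_bigr => i _.
by rewrite !mxE inE e_sym; case: (i \in S); rewrite ?subrr ?subr0 ?mul0r ?mul1r.
Qed.

Lemma cut_size_lower_bound (s : seq R) (S : {set 'I_n}) :
  ordered_eigenvalues L s -> 0 < s`_1 ->
  s`_1 * #|S|%:R * #|~: S|%:R <= n%:R * (cut_size e S)%:R.
Proof.
(* The case [n = 0] is set apart: the all-ones vector must be nonzero, and a factor [n] is cancelled
   at the end. *)
move=> sP s1_gt0; have [n0|n_gt0] := posnP n.
  have -> : #|S| = 0%N.
    by apply: eq_card0 => i; have := ltn_ord i; rewrite {2}n0.
  by rewrite mulr0 mul0r mulr_ge0.
pose x := \row_v (v \in S)%:R : 'rV[R]_n.
pose z := n%:R *: x - const_mx #|S|%:R.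
have x_sum : \sum_i x 0 i = #|S|%:R.
  rewrite -sum1_card natr_sum [RHS]big_mkcond /=.
  by apply: eq_bigr => i _; rewrite mxE; case: (i \in S).
have z_orth : z *m (const_mx 1 : 'rV_n)^T = 0.
  apply/rowP => k; rewrite !mxE.
  under eq_bigr => i _ do rewrite !mxE mulr1.
  rewrite sumrB -mulr_sumr sumr_const card_ord mulr_natl.
  have -> : \sum_(i < n) (i \in S)%:R = #|S|%:R :> R.
    by rewrite -x_sum; apply: eq_bigr => i _; rewrite mxE.
  by rewrite subrr.
have u_neq0 : (const_mx 1 : 'rV[R]_n) != 0.
  apply/rV0Pn; exists (Ordinal n_gt0); rewrite mxE; exact: oner_neq0.
have uL : (const_mx 1 : 'rV[R]_n) *m L = 0 *: (const_mx 1 : 'rV[R]_n).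
  by rewrite mul_const_laplacian scale0r.
have := rayleigh_second_eigenvalue laplacian_mx_sym sP u_neq0 uL s1_gt0 z_orth.
have zL : z *m L = n%:R *: (x *m L).
  by rewrite mulmxBl mul_const_laplacian subr0 scalemxAl.
have Lz : L *m z^T = n%:R *: (L *m x^T).
  rewrite -{1}laplacian_mx_sym -trmx_mul zL linearZ /= trmx_mul.
  by rewrite laplacian_mx_sym.
(* The constant part of [z] is killed on both sides of [L], leaving [n ^ 2] times the form at
   [x]. *)
have -> : z *m L *m z^T = n%:R *: (n%:R *: (x *m L *m x^T)).
  by rewrite zL -scalemxAl -mulmxA Lz -scalemxAr mulmxA.
have cardS : #|~: S|%:R = n%:R - #|S|%:R :> R.
  have := congr1 (fun k => k%:R : R) (cardsC S).
  by rewrite card_ord natrD => <-; rewrite addrC addKr.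
have -> : (z *m z^T) 0 0 = n%:R * (#|S|%:R * #|~: S|%:R).
  (* Entries of [x] are 0 or 1, hence equal to their squares, so each squared entry of [z] is affine
     in [x 0 i]. *)
  rewrite mxE (eq_bigr (fun i => (n%:R ^+ 2 - 2 * n%:R * #|S|%:R) * x 0 i
     + #|S|%:R ^+ 2)) => [|i _]; last first.
    by rewrite !mxE; case: (i \in S) => /=; ring.
  rewrite big_split /= -mulr_sumr x_sum sumr_const card_ord cardS -mulr_natl.
  by ring.
rewrite [X in _ <= X]mxE [X in _ <= _ * X]mxE laplacian_form_cut mulrCA.
by rewrite ler_pM2l ?ltr0n // mulrA.
Qed.

End Laplacian.

(** * Minimum degree and disconnecting edge sets *)

Lemma min_degree_le (n : nat) (e : rel 'I_n) v : (min_degree e <= degree e v)%N.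
Proof. by rewrite /min_degree -leEnat -minEnat bigmin_le. Qed.

Lemma min_degree_attained (n : nat) (e : rel 'I_n) :
  (0 < n)%N -> exists v, degree e v = min_degree e.
Proof.
move=> n_gt0; rewrite /min_degree -minEnat.
have [//|i _|v _ ->] := @eq_bigmin _ _ _ n (Ordinal n_gt0) predT (degree e).
  by rewrite leEnat -[X in (_ <= X)%N]card_ord max_card.
by exists v.
Qed.

(** Used twice: for all of [edges e], so that the minimum ranges over a nonempty family, and for the
    edges at a vertex of minimum degree. *)
Lemma isolated_disconnecting (n : nat) (e : rel 'I_n) (F : {set {set 'I_n}}) v :
  (1 < n)%N -> F \subset edges e -> (forall w, e v w -> [set v; w] \in F) ->
  disconnecting e F.
Proof.
move=> n_gt1 F_edges v_isolated; rewrite /disconnecting F_edges /=.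
have [w w_neq] : exists w, w != v.
  have : (0 < #|predC1 v|)%N by rewrite cardC1 card_ord -subn1 subn_gt0.
  by case/card_gt0P => w w_neq; exists w.
apply/forallPn; exists v; apply/forallPn; exists w.
apply/negP => /connectP [[|x p] /=]; first by move=> _ wv; rewrite wv eqxx in w_neq.
by case/andP => /andP [/v_isolated ->].
Qed.

(** Take for [S] what is reachable from [x] after the deletion: an edge leaving [S] outside [F]
    would make its far end reachable. *)
Lemma disconnecting_cut (n : nat) (e : rel 'I_n) (F : {set {set 'I_n}}) :
  disconnecting e F ->
  exists S : {set 'I_n},
    [/\ (0 < #|S|)%N, (0 < #|~: S|)%N & (cut_size e S <= #|F|)%N].
Proof.
case/andP => _ /forallPn [x /forallPn [y xNy]].
pose S := [set z | connect (delete_edges e F) x z]; exists S; split.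
- by apply/card_gt0P; exists x; rewrite inE connect0.
- by apply/card_gt0P; exists y; rewrite !inE.
pose A := [set p : 'I_n * 'I_n | (p.1 \in S) && (p.2 \in ~: S) && e p.1 p.2].
have -> : cut_size e S = #|A|.
  rewrite /cut_size pair_big /= -sum1_card [RHS]big_mkcond [LHS]big_mkcond /=.
  by apply: eq_bigr => p _; rewrite !inE; case: ifP => //=; case: (e _ _).
(* Exactly one end of a crossing edge lies in [S], so the unordered pair determines the
   orientation. *)
have A_inj : {in A &, injective (fun p : 'I_n * 'I_n => [set p.1; p.2])}.
  have AE p : (p \in A) = (p.1 \in S) && (p.2 \in ~: S) && e p.1 p.2.
    by rewrite in_set.
  case=> u v [u' v']; rewrite !AE /= => /andP [/andP [uS vS] _].
  move=> /andP [/andP [u'S v'S] _] eq_uv.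
  have S_neq a b : a \in S -> b \in ~: S -> a == b = false.
    by move=> aS bS; apply: contraTF bS => /eqP <-; rewrite in_setC aS.
  move/setP: eq_uv => eq_uv; congr (_, _).
    by move: (eq_uv u); rewrite !in_set2 eqxx (S_neq u v') // orbF => /esym /eqP.
  move: (eq_uv v); rewrite !in_set2 eqxx orbT [v == u']eq_sym (S_neq u' v) //=.
  by move=> /esym /eqP.
rewrite -(card_in_imset A_inj); apply/subset_leq_card/subsetP => _ /imsetP [p pA ->].
move: pA; rewrite !inE => /andP [/andP [xp1 xNp2] ep].
apply: contraR xNp2 => pF; apply: connect_trans xp1 (connect1 _).
by rewrite /delete_edges /= ep pF.
Qed.

(** * Every cut has at least minimum degree many edges; conclusion *)

Lemma small_cut_ge_min_degree (n : nat) (e : rel 'I_n) (S : {set 'I_n}) :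
  irreflexive e -> (0 < #|S| <= min_degree e)%N -> (min_degree e <= cut_size e S)%N.
Proof.
move=> e_irr /andP [S_gt0 S_le].
have out_ge u : u \in S ->
    (min_degree e - #|S|.-1 <= \sum_(v in ~: S) e u v)%N.
  move=> uS; rewrite leq_subLR; apply: leq_trans (min_degree_le e u) _.
  rewrite degreeE (bigID (mem S)) /= leq_add //.
    rewrite (bigD1 u) //= e_irr add0n (cardsD1 u S) uS add1n /= -sum1_card.
    rewrite [leqRHS](eq_bigl (fun v => (v \in S) && (v != u))); last first.
      by move=> v; rewrite !inE andbC.
    by apply: leq_sum => v _; apply: leq_b1.
  by rewrite (eq_bigl [in ~: S]) // => v; rewrite inE.
have : (#|S| * (min_degree e - #|S|.-1) <= cut_size e S)%N.
  by rewrite -sum_nat_const; apply: leq_sum.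
(* With [k] for the size of [S] and [m] for the minimum degree,
   [k * (m - k + 1) - m = (k - 1) * (m - k)], which is nonnegative. *)
by apply: leq_trans; nia.
Qed.

Lemma cut_ge_min_degree (R : rcfType) (n : nat) (e : rel 'I_n) (s : seq R)
    (S : {set 'I_n}) :
  symmetric e -> irreflexive e ->
  ordered_eigenvalues (laplacian_mx R e) s -> 2 <= s`_1 ->
  (0 < #|S|)%N -> (0 < #|~: S|)%N -> (min_degree e <= cut_size e S)%N.
Proof.
move=> e_sym e_irr sP s1_ge2.
wlog S_le : S / (#|S| <= #|~: S|)%N => [IH S_gt0 SC_gt0|S_gt0 _].
  case/orP: (leq_total #|S| #|~: S|) => [/IH|le_S]; first exact.
  by rewrite -(cut_sizeC S e_sym); apply: IH; rewrite ?setCK.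
have [small|large] := leqP #|S| (min_degree e).
  by apply: small_cut_ge_min_degree; rewrite // S_gt0.
have : (2 * #|S| * #|~: S| <= n * cut_size e S)%N.
  rewrite -(ler_nat R) !natrM.
  apply: le_trans (cut_size_lower_bound e_sym S sP _); last by lra.
  by rewrite -!mulrA ler_wpM2r // -natrM.
have := cardsC S; rewrite card_ord; nia.
Qed.

Theorem theorem2p3 (R : rcfType) (n : nat) (e : rel 'I_n)
    (e_sym : symmetric e) (e_irr : irreflexive e)
    (sigma : seq R)
    (sigmaP : ordered_eigenvalues (laplacian_mx R e) sigma)
    (sigma_lb : 2 <= sigma`_1)
    (sigma_mid : sigma`_1 <= sigma`_n.-1)
    (sigma_ub : sigma`_n.-1 <= 2 * average_degree R e - 2) :
  edge_connectivity e = min_degree e.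
Proof.
have n_gt1 : (1 < n)%N.
  rewrite -ltnS -(size_char_poly (laplacian_mx R e)) sigmaP.2 size_prod_XsubC ltnS.
  rewrite ltnNge; apply: contraTN sigma_lb => /(nth_default 0) ->.
  by rewrite -ltNge.
have n_gt0 : (0 < n)%N := ltnW n_gt1.
have edgesP u w : e u w -> [set u; w] \in edges e.
  by move=> uw; apply/imsetP; exists (u, w).
rewrite /edge_connectivity; case: arg_minnP => [|F F_disc F_min].
  by apply: (isolated_disconnecting (v := Ordinal n_gt0)) => // w; apply: edgesP.
apply/eqP; rewrite eqn_leq; apply/andP; split; last first.
  have [S [S_gt0 SC_gt0]] := disconnecting_cut F_disc; apply: leq_trans.
  exact: cut_ge_min_degree sigmaP _ _ _.
(* Upper bound: deleting the edges at a vertex of minimum degree isolates it. *)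
have [v <-] := min_degree_attained e n_gt0.
apply: leq_trans (leq_imset_card (fun w => [set v; w]) [set w | e v w]).
apply: F_min; apply: (isolated_disconnecting (v := v)) => // [|w vw].
  by apply/subsetP => x /imsetP [w]; rewrite inE => vw ->; apply: edgesP.
by apply: imset_f; rewrite inE.
Qed.
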